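(* Let $\mathcal{H}=(X;\tau_0,\tau_1,\tau_2)$ be a hypermap and let $A\subseteq\mathcal{E}(\mathcal{H})$. Then the partial dual $\mathcal{H}^A$ is bipartite if and only if, for any local orientation system $\omega$ for $M(\mathcal{H})$, the modified medial map $\widehat M_\omega(\mathcal{H})$ admits an all-crossing orientation $\Phi$ such that $A=C(\Phi)$.
   Context: A hypermap is a triple $\mathcal{H}=(X;\tau_0,\tau_1,\tau_2)$ where $X$ is a finite set (of flags), each $\tau_i$ is a fixed-point-free involution on $X$, and $\langle\tau_0,\tau_1,\tau_2\rangle$ acts transitively on $X$. Vertices and hyperedges are the orbits $\mathcal{V}(\mathcal{H})=X/\langle\tau_1,\tau_2\rangle$ and $\mathcal{E}(\mathcal{H})=X/\langle\tau_0,\tau_2\rangle$. $\mathcal{H}$ is bipartite if its vertex-adjacency multigraph is bipartite; this multigraph has vertex set $\mathcal{V}(\mathcal{H})$ and, for every pair $\{x,\tau_0x\}$, one edge joining the vertex orbits containing $x$ and $\tau_0x$ (loops and multiple edges allowed). Equivalently, there is $\chi:\mathcal{V}(\mathcal{H})\to\{+1,-1\}$ with $\chi(V(x))=-\chi(V(\tau_0x))$ for all $x\in X$, where $V(x)$ is the $\langle\tau_1,\tau_2\rangle$-orbit of $x$. Partial dual: for $A\subseteq\mathcal{E}(\mathcal{H})$ let $X_A=\bigcup_{e\in A}e$. Then $\mathcal{H}^A=(X;\tau_0^A,\tau_1,\tau_2^A)$, where for $x\in X_A$: $\tau_0^A(x)=\tau_2(x)$, $\tau_2^A(x)=\tau_0(x)$;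 and for $x\notin X_A$: $\tau_0^A(x)=\tau_0(x)$, $\tau_2^A(x)=\tau_2(x)$. Medial map: $M(\mathcal{H})=(Y;\mu_0,\mu_1,\mu_2)$ with $Y=X\times\{\mathsf b,\mathsf w\}$, $\mu_0(x,c)=(\tau_1x,c)$, $\mu_2(x,c)=(x,\bar c)$ (where $\bar c$ is the symbol other than $c$), $\mu_1(x,\mathsf b)=(\tau_2x,\mathsf b)$, $\mu_1(x,\mathsf w)=(\tau_0x,\mathsf w)$. Its vertices (medial vertices) are the sets $e\times\{\mathsf b,\mathsf w\}$, $e\in\mathcal{E}(\mathcal{H})$, identified with hyperedges; its half-edges are identified with the flags $x\in X$ (the half-edge $x$ is incident with the medial vertex $e\ni x$); its edges (medial edges) correspond to the pairs $\{x,\tau_1x\}$. A local orientation system for $M(\mathcal{H})$ is a map $\omega:X\to\{+1,-1\}$ with $\omega(\tau_0x)=-\omega(x)$ and $\omega(\tau_2x)=-\omega(x)$ for all $x\in X$ (such maps always exist). For a medial edge $a=\{x,\tau_1x\}$ the twist indicator $\varepsilon_\omega(a)\in\{0,1\}$ is defined by $\omega(\tau_1x)=(-1)^{1+\varepsilon_\omega(a)}\omega(x)$. The modified medial map $\widehat M_\omega(\mathcal{H})$ is obtained from $M(\mathcal{H})$ by inserting one artificial bivalent vertex (''bar'') into each medial edge $a$ with $\varepsilon_\omega(a)=1$, splitting it into two segments. The orientations of $\widehat M_\omega(\mathcal{H})$ considered are those for which every artificial bar is a source or a sink. Such an orientation is encoded by $\delta:X\to\{+1,-1\}$, where $\delta(x)=+1$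 if the edge segment at the half-edge $x$ is directed away from its incident original medial vertex and $\delta(x)=-1$ if it is directed towards it; these orientations are exactly the maps $\delta$ satisfying $\delta(\tau_1x)=(-1)^{1+\varepsilon_\omega(\{x,\tau_1x\})}\delta(x)$ for all $x\in X$. Let $\Phi$ be such an orientation, encoded by $\delta$. A hyperedge $e$ (original medial vertex) is a $c$-type all-crossing vertex if $\delta(\tau_2x)=\delta(x)$ and $\delta(\tau_0x)=-\delta(x)$ for every $x\in e$; it is a $d$-type all-crossing vertex if $\delta(\tau_0x)=\delta(x)$ and $\delta(\tau_2x)=-\delta(x)$ for every $x\in e$. $\Phi$ is all-crossing if every original medial vertex is of exactly one of these two types; $C(\Phi)$ denotes the set of its $c$-type hyperedges. *)

(* Defs.v *)
From HB Require Import structures.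
From mathcomp Require Import all_boot all_fingroup.

Set Implicit Arguments.
Unset Strict Implicit.
Unset Printing Implicit Defensive.

Local Open Scope group_scope.

(* Signs in {+1, -1} are booleans throughout: true is +1, false is -1, and
   sign change is negb. *)

Definition fpf_involution (T : finType) (s : {perm T}) : Prop :=
  involutive s /\ forall x, s x != x.

(* Transitivity of an action on [set: flag] entails flag is inhabited. *)
Record hypermap := Hypermap {
  flag : finType;
  tau0 : {perm flag};
  tau1 : {perm flag};
  tau2 : {perm flag};
  tau0_fpf : fpf_involution tau0;
  tau1_fpf : fpf_involution tau1;
  tau2_fpf : fpf_involution tau2;
  hypermap_trans :
    [transitive <<[set tau0; tau1; tau2]>>, on [set: flag] | 'P]
}.

Section Basics.
Variable H : hypermap.
Implicit Types x : flag H.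

Definition vertex_of x : {set flag H} :=
  orbit 'P <<[set tau1 H; tau2 H]>> x.
Definition hyperedge_of x : {set flag H} :=
  orbit 'P <<[set tau0 H; tau2 H]>> x.

Definition vertices : {set {set flag H}} := [set vertex_of x | x : flag H].
Definition hyperedges : {set {set flag H}} := [set hyperedge_of x | x : flag H].

(* The edge set of the vertex-adjacency multigraph is the set of pairs
   {x, tau0 x}; distinct pairs may have the same ends, and the set of ends of
   a loop is a singleton. *)
Definition adjacency_edges : {set {set flag H}} :=
  [set [set x; tau0 H x] | x : flag H].
Definition ends (a : {set flag H}) : {set {set flag H}} :=
  [set vertex_of x | x in a].

Definition bipartite : Prop :=
  exists P Q : {set {set flag H}},
    [/\ P :|: Q = vertices, [disjoint P & Q] &
        forall a, a \in adjacency_edges ->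
          exists v w, [/\ v \in P, w \in Q & ends a = [set v; w]]].

Lemma tau0K : involutive (tau0 H). Proof. by case: (tau0_fpf H). Qed.
Lemma tau1K : involutive (tau1 H). Proof. by case: (tau1_fpf H). Qed.
Lemma tau2K : involutive (tau2 H). Proof. by case: (tau2_fpf H). Qed.
Lemma tau0_neq x : tau0 H x != x. Proof. by case: (tau0_fpf H). Qed.
Lemma tau1_neq x : tau1 H x != x. Proof. by case: (tau1_fpf H). Qed.
Lemma tau2_neq x : tau2 H x != x. Proof. by case: (tau2_fpf H). Qed.

End Basics.

Lemma fpf_involution_perm (T : finType) (f : T -> T) (fK : involutive f) :
  (forall x, f x != x) -> fpf_involution (perm (inv_inj fK)).
Proof. by move=> fN; split=> x; rewrite !permE // fK. Qed.

Lemma orbit_gen_sub (T : finType) (B : {set {perm T}}) (S : {set T}) x :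
  (forall s y, s \in B -> y \in S -> s y \in S) -> x \in S ->
  orbit 'P <<B>> x \subset S.
Proof.
move=> cS xS; have aBS : <<B>> \subset 'N(S | 'P).
  rewrite gen_subG; apply/subsetP=> s sB; rewrite !inE /=.
  by apply/subsetP=> y yS; rewrite inE; apply: cS.
by rewrite acts_sub_orbit.
Qed.

Lemma hypermap_ind (H : hypermap) (S : {set flag H}) x0 :
  x0 \in S ->
  (forall x, x \in S -> [/\ tau0 H x \in S, tau1 H x \in S & tau2 H x \in S]) ->
  forall x, x \in S.
Proof.
move=> x0S cS x.
have := atransP (hypermap_trans H) x0 (in_setT _) => oE.
have: x \in [set: flag H] by [].
rewrite -oE; apply/subsetP/orbit_gen_sub => // s y.
by rewrite !inE => /orP[/orP[]|] /eqP-> /cS[].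
Qed.

Lemma trans_intro (T : finType) (a b c : {perm T}) x0 :
  (forall S : {set T}, x0 \in S ->
     (forall x, x \in S -> [/\ a x \in S, b x \in S & c x \in S]) ->
     forall x, x \in S) ->
  [transitive <<[set a; b; c]>>, on [set: T] | 'P].
Proof.
move=> ind; apply/imsetP; exists x0 => //; apply/esym/setP=> x.
rewrite [RHS]in_setT; apply: ind x => [|x xO]; first exact: orbit_refl.
have step s : s \in [set a; b; c] ->
    s x \in orbit 'P <<[set a; b; c]>> x0.
  by move=> sB; apply: orbit_trans xO; apply: (mem_orbit 'P x (mem_gen sB)).
by split; apply: step; rewrite !inE eqxx ?orbT.
Qed.

Lemma hypermap_inhabited (H : hypermap) : exists x : flag H, True.
Proof. by case/imsetP: (hypermap_trans H) => x; exists x. Qed.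

Section PartialDual.
Variables (H : hypermap) (A : {set {set flag H}}).
Hypothesis hA : A \subset hyperedges H.

Lemma cover_tau x :
  (tau0 H x \in cover A) = (x \in cover A) /\
  (tau2 H x \in cover A) = (x \in cover A).
Proof.
have step s y : s \in [set tau0 H; tau2 H] -> y \in cover A ->
    s y \in cover A.
  move=> sB /bigcupP[e eA ye]; apply/bigcupP; exists e => //.
  case/imsetP: (subsetP hA _ eA) => z _ def_e; rewrite def_e in ye *.
  exact: (orbit_trans (mem_orbit 'P y (mem_gen sB)) ye).
split; apply/idP/idP => h.
- by rewrite -(tau0K x); apply: step; rewrite // !inE eqxx.
- by apply: step; rewrite // !inE eqxx.
- by rewrite -(tau2K x); apply: step; rewrite // !inE eqxx orbT.
- by apply: step; rewrite // !inE eqxx orbT.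
Qed.

Definition dual_tau0 (x : flag H) :=
  if x \in cover A then tau2 H x else tau0 H x.
Definition dual_tau2 (x : flag H) :=
  if x \in cover A then tau0 H x else tau2 H x.

Lemma dual_tau0K : involutive dual_tau0.
Proof.
move=> x; have [c0 c2] := cover_tau x; rewrite /dual_tau0.
by case xA: (x \in cover A); rewrite ?c0 ?c2 xA ?tau0K ?tau2K.
Qed.

Lemma dual_tau2K : involutive dual_tau2.
Proof.
move=> x; have [c0 c2] := cover_tau x; rewrite /dual_tau2.
by case xA: (x \in cover A); rewrite ?c0 ?c2 xA ?tau0K ?tau2K.
Qed.

Lemma dual_tau0_fpf : fpf_involution (perm (inv_inj dual_tau0K)).
Proof.
apply: fpf_involution_perm => x; rewrite /dual_tau0.
by case: ifP; rewrite ?tau0_neq ?tau2_neq.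
Qed.

Lemma dual_tau2_fpf : fpf_involution (perm (inv_inj dual_tau2K)).
Proof.
apply: fpf_involution_perm => x; rewrite /dual_tau2.
by case: ifP; rewrite ?tau0_neq ?tau2_neq.
Qed.

Lemma dual_trans :
  [transitive <<[set perm (inv_inj dual_tau0K); tau1 H;
                     perm (inv_inj dual_tau2K)]>>, on [set: flag H] | 'P].
Proof.
have [x0 _] := hypermap_inhabited H.
apply: (@trans_intro _ _ _ _ x0) => S x0S cS; apply: (hypermap_ind x0S) => x.
case/cS; rewrite !permE /dual_tau0 /dual_tau2.
by case: ifP.
Qed.

Definition partial_dual : hypermap :=
  Hypermap dual_tau0_fpf (tau1_fpf H) dual_tau2_fpf dual_trans.

End PartialDual.

Section Medial.
Variable H : hypermap.

(* In (x, c), c = true is the symbol b and c = false is the symbol w. *)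
Definition medial_mu0 (y : flag H * bool) := (tau1 H y.1, y.2).
Definition medial_mu1 (y : flag H * bool) :=
  (if y.2 then tau2 H y.1 else tau0 H y.1, y.2).
Definition medial_mu2 (y : flag H * bool) := (y.1, ~~ y.2).

Lemma medial_mu0K : involutive medial_mu0.
Proof. by case=> x c; rewrite /medial_mu0 /= tau1K. Qed.
Lemma medial_mu1K : involutive medial_mu1.
Proof. by case=> x []; rewrite /medial_mu1 /= ?tau0K ?tau2K. Qed.
Lemma medial_mu2K : involutive medial_mu2.
Proof. by case=> x c; rewrite /medial_mu2 /= negbK. Qed.

Lemma medial_mu0_fpf : fpf_involution (perm (inv_inj medial_mu0K)).
Proof.
by apply: fpf_involution_perm => -[x c]; rewrite xpair_eqE (negPf (tau1_neq _)).
Qed.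
Lemma medial_mu1_fpf : fpf_involution (perm (inv_inj medial_mu1K)).
Proof.
apply: fpf_involution_perm => -[x []]; rewrite xpair_eqE /=.
  by rewrite (negPf (tau2_neq _)).
by rewrite (negPf (tau0_neq _)).
Qed.
Lemma medial_mu2_fpf : fpf_involution (perm (inv_inj medial_mu2K)).
Proof. by apply: fpf_involution_perm => -[x []]; rewrite xpair_eqE andbF. Qed.

Lemma medial_trans :
  [transitive <<[set perm (inv_inj medial_mu0K); perm (inv_inj medial_mu1K);
                     perm (inv_inj medial_mu2K)]>>,
    on [set: (flag H * bool)%type] | 'P].
Proof.
have [x0 _] := hypermap_inhabited H.
apply: (@trans_intro _ _ _ _ (x0, true)) => S x0S cS.
have cS0 x c : (x, c) \in S -> (tau1 H x, c) \in S.
  by case/cS; rewrite !permE.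
have cS1 x c : (x, c) \in S -> (if c then tau2 H x else tau0 H x, c) \in S.
  by case/cS; rewrite !permE.
have cS2 x c : (x, c) \in S -> (x, ~~ c) \in S.
  by case/cS; rewrite !permE.
have inS x : x \in [set x | (x, true) \in S].
  apply: (hypermap_ind (x0 := x0)) => [|{}x]; rewrite !inE // => xS; split.
  - exact: (cS2 _ false (cS1 _ false (cS2 _ true xS))).
  - exact: cS0.
  - exact: (cS1 _ true).
case=> x c; have := inS x; rewrite inE; case: c => // xS.
exact: (cS2 _ true).
Qed.

Definition medial : hypermap :=
  Hypermap medial_mu0_fpf medial_mu1_fpf medial_mu2_fpf medial_trans.

End Medial.

(* Insertion of a bivalent vertex (bar) into each edge of the map M whose flags
   lie in T.  The flags of M are kept as inl y; on an edge in T, inr y is the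
   flag of the same segment and side as inl y, but at the bar. *)
Section InsertBars.
Variables (M : hypermap) (T : {set flag M}).
Hypothesis T0 : forall y, (tau0 M y \in T) = (y \in T).
Hypothesis T2 : forall y, (tau2 M y \in T) = (y \in T).

Definition bar_flag : finType := (flag M + {y : flag M | y \in T})%type.

Definition bar_tau0 (f : bar_flag) : bar_flag :=
  match f with
  | inl y => if insub y is Some z then inr z else inl (tau0 M y)
  | inr z => inl (val z)
  end.
Definition bar_tau1 (f : bar_flag) : bar_flag :=
  match f with
  | inl y => inl (tau1 M y)
  | inr (exist y yT) => inr (exist _ (tau0 M y) (etrans (T0 y) yT))
  end.
Definition bar_tau2 (f : bar_flag) : bar_flag :=
  match f with
  | inl y => inl (tau2 M y)
  | inr (exist y yT) => inr (exist _ (tau2 M y) (etrans (T2 y) yT))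
  end.

Lemma bar_tau0K : involutive bar_tau0.
Proof.
case=> [y|z] /=; last by rewrite valK.
case: insubP => [z _ <- //|yT] /=.
by rewrite insubN ?T0 // tau0K.
Qed.
Lemma bar_tau1K : involutive bar_tau1.
Proof.
case=> [y|[y yT]] /=; first by rewrite tau1K.
by congr inr; apply: val_inj; rewrite /= tau0K.
Qed.
Lemma bar_tau2K : involutive bar_tau2.
Proof.
case=> [y|[y yT]] /=; first by rewrite tau2K.
by congr inr; apply: val_inj; rewrite /= tau2K.
Qed.

Lemma bar_tau0_fpf : fpf_involution (perm (inv_inj bar_tau0K)).
Proof.
apply: fpf_involution_perm => -[y|z] //=.
by case: insubP => // _; apply/eqP=> -[] /eqP; rewrite (negPf (tau0_neq _)).
Qed.
Lemma bar_tau1_fpf : fpf_involution (perm (inv_inj bar_tau1K)).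
Proof.
apply: fpf_involution_perm => -[y|[y yT]] /=; apply/eqP=> -[] /eqP.
  by rewrite (negPf (tau1_neq _)).
by rewrite (negPf (tau0_neq _)).
Qed.
Lemma bar_tau2_fpf : fpf_involution (perm (inv_inj bar_tau2K)).
Proof.
by apply: fpf_involution_perm => -[y|[y yT]] /=; apply/eqP=> -[] /eqP;
  rewrite (negPf (tau2_neq _)).
Qed.

Lemma bar_trans :
  [transitive <<[set perm (inv_inj bar_tau0K); perm (inv_inj bar_tau1K);
                     perm (inv_inj bar_tau2K)]>>, on [set: bar_flag] | 'P].
Proof.
have [y0 _] := hypermap_inhabited M.
apply: (@trans_intro _ _ _ _ (inl y0 : bar_flag)) => S y0S cS.
have cS0 f : f \in S -> bar_tau0 f \in S by case/cS; rewrite !permE.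
have cS1 f : f \in S -> bar_tau1 f \in S by case/cS; rewrite !permE.
have cS2 f : f \in S -> bar_tau2 f \in S by case/cS; rewrite !permE.
have inS y : y \in [set y | (inl y : bar_flag) \in S].
  apply: (hypermap_ind (x0 := y0)) => [|{}y]; rewrite !inE // => yS; split.
  - have := cS0 _ yS; rewrite /=; case: insubP => // -[z zT] _ /= <- zS.
    exact: (cS0 _ (cS1 _ zS)).
  - exact: (cS1 _ yS).
  - exact: (cS2 _ yS).
case=> [y|z]; first by have := inS y; rewrite inE.
have := inS (val z); rewrite inE => /cS0 /=.
by rewrite valK.
Qed.

Definition insert_bars : hypermap :=
  Hypermap bar_tau0_fpf bar_tau1_fpf bar_tau2_fpf bar_trans.

End InsertBars.

Section Orientations.
Variable M : hypermap.

(* A half-edge of the map M is a pair {f, tau2 f}, and tau0 exchanges the two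
   half-edges of an edge.  An orientation is given by o, where o f holds iff
   the edge at f is directed away from the vertex of f. *)
Definition orientation (o : flag M -> bool) : Prop :=
  (forall f, o (tau2 M f) = o f) /\ (forall f, o (tau0 M f) = ~~ o f).

Definition source (o : flag M -> bool) (v : {set flag M}) : Prop :=
  forall f, f \in v -> o f.
Definition sink (o : flag M -> bool) (v : {set flag M}) : Prop :=
  forall f, f \in v -> ~~ o f.

End Orientations.

Section ModifiedMedial.
Variables (H : hypermap) (omega : flag H -> bool).

Definition local_orientation : Prop :=
  (forall x, omega (tau0 H x) = ~~ omega x) /\
  (forall x, omega (tau2 H x) = ~~ omega x).

(* The twist indicator of the medial edge {x, tau1 x}. *)
Definition twist (x : flag H) : bool := omega (tau1 H x) == omega x.

Lemma twistE x : omega (tau1 H x) = ~~ omega x (+) twist x.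
Proof. by rewrite /twist; case: (omega _); case: (omega _). Qed.

Definition twisted : {set flag (medial H)} := [set y | twist y.1].

Lemma twisted0 y : (tau0 (medial H) y \in twisted) = (y \in twisted).
Proof. by rewrite !inE permE /twist /= tau1K eq_sym. Qed.
Lemma twisted2 y : (tau2 (medial H) y \in twisted) = (y \in twisted).
Proof. by rewrite !inE permE. Qed.

Definition modified_medial : hypermap := insert_bars twisted0 twisted2.

Implicit Types (o : flag modified_medial -> bool) (e : {set flag H}).

Definition bars_source_or_sink o : Prop :=
  forall z : {y | y \in twisted},
    let bar := @vertex_of modified_medial (inr z) in
    source o bar \/ sink o bar.

(* The flags (x, b) and (x, w) of the medial map lie on the same half-edge x,
   so an orientation o takes the same value on both. *)
Definition delta o (x : flag H) : bool := o (inl (x, true)).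

Definition c_type o e : bool :=
  [forall x in e, (delta o (tau2 H x) == delta o x) &&
                  (delta o (tau0 H x) == ~~ delta o x)].
Definition d_type o e : bool :=
  [forall x in e, (delta o (tau0 H x) == delta o x) &&
                  (delta o (tau2 H x) == ~~ delta o x)].

Definition all_crossing o : Prop :=
  forall e, e \in hyperedges H -> c_type o e (+) d_type o e.

Definition c_hyperedges o : {set {set flag H}} :=
  [set e in hyperedges H | c_type o e].

End ModifiedMedial.

(* Main.v *)
Require Import Defs.
From mathcomp Require Import all_boot all_fingroup.

(** Signs multiply as [(+)] on booleans, and the whole equivalence is the change
    of variable [delta = chi * omega].

    A hypermap is bipartite iff its flags carry a sign [chi] that [tau1] and
    [tau2] preserve and [tau0] reverses ([bipartite_flag_coloring]).
    An orientation of the modified medial map whose bars are sources or sinks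
    amounts to a sign [delta] on flags which changes along [tau1] exactly as
    [omega] does ([delta_tau1], [orientation_of_delta]); so the product
    [chi = delta * omega] is [tau1]-invariant.  Since [omega] is reversed by
    both [tau0] and [tau2], multiplying by [omega] exchanges preserved and
    reversed on a hyperedge: where [delta] is of c-type, [chi] is preserved by
    [tau0] and reversed by [tau2], and where [delta] is of d-type it is the other
    way round.  As partial duality swaps [tau0] and [tau2] exactly on the
    hyperedges of [A], being a coloring of the partial dual means that the
    hyperedges in [A] are of c-type and the others of d-type.

    For the implication from orientations to bipartiteness one needs at least one
    local orientation system; it exists because [tau0] and [tau2] are perfect
    matchings, whose union has only even cycles
    ([exists_local_orientation]). *)

Set Implicit Arguments.
Unset Strict Implicit.
Unset Printing Implicit Defensive.

Lemma vertex_of_tau1 (H : hypermap) (x : flag H) :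
  vertex_of (tau1 H x) = vertex_of x.
Proof. by apply: (orbit_act 'P x); rewrite mem_gen // !inE eqxx. Qed.

Lemma vertex_of_tau2 (H : hypermap) (x : flag H) :
  vertex_of (tau2 H x) = vertex_of x.
Proof. by apply: (orbit_act 'P x); rewrite mem_gen // !inE eqxx orbT. Qed.

Lemma vertex_of_invariant (H : hypermap) (f : flag H -> bool) :
  (forall x, f (tau1 H x) = f x) -> (forall x, f (tau2 H x) = f x) ->
  forall x y, y \in vertex_of x -> f y = f x.
Proof.
move=> f1 f2 x y yx; apply/eqP.
suff /subsetP/(_ _ yx) : vertex_of x \subset [set z | f z == f x] by rewrite inE.
apply: orbit_gen_sub => [s z|]; last by rewrite inE.
by rewrite !inE => /orP[] /eqP-> ?; rewrite (f1, f2).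
Qed.

Lemma hyperedge_of_invariant (H : hypermap) (x y : flag H) :
  y \in hyperedge_of x -> hyperedge_of y = hyperedge_of x.
Proof. by move/orbit_eqP. Qed.

Lemma mem_hyperedge_of (H : hypermap) (x : flag H) : x \in hyperedge_of x.
Proof. exact: orbit_refl. Qed.

Lemma hyperedge_of_in (H : hypermap) (x : flag H) :
  hyperedge_of x \in hyperedges H.
Proof. exact: imset_f. Qed.

Lemma mem_cover_hyperedges (H : hypermap) (A : {set {set flag H}}) x :
  A \subset hyperedges H -> (x \in cover A) = (hyperedge_of x \in A).
Proof.
move=> /subsetP hA; apply/bigcupP/idP => [[e eA xe]|]; last first.
  by exists (hyperedge_of x); rewrite ?mem_hyperedge_of.
have /imsetP[z _ def_e] := hA _ eA.
by rewrite def_e in eA xe; rewrite (hyperedge_of_invariant xe).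
Qed.

(** * Bipartiteness as a sign on flags *)

Definition flag_coloring (H : hypermap) (chi : flag H -> bool) : Prop :=
  [/\ forall x, chi (tau0 H x) = ~~ chi x,
      forall x, chi (tau1 H x) = chi x &
      forall x, chi (tau2 H x) = chi x].

Lemma bipartite_flag_coloring (H : hypermap) :
  bipartite H <-> exists chi : flag H -> bool, flag_coloring chi.
Proof.
split=> [[P [Q [_ dPQ hPQ]]] | [chi [chi0 chi1 chi2]]].
  exists (fun x => vertex_of x \in P); split=> x.
  - have /hPQ[v [w [vP wQ]]] : [set x; tau0 H x] \in adjacency_edges H.
      exact: imset_f.
    have wP : w \in P = false by apply: (disjointFl dPQ).
    rewrite /ends imsetU1 imset_set1 => /setP eq_ends.
    have := eq_ends v; have := eq_ends w; rewrite !inE !eqxx orbT /=.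
    have neq_vw : v == w = false by apply/eqP=> e; rewrite e wP in vP.
    (* The ends are v and w in some order; a loop would identify them. *)
    case/orP=> /eqP def_w; case/orP=> /eqP def_v.
    + by rewrite def_v def_w eqxx in neq_vw.
    + by rewrite -def_v -def_w vP wP.
    + by rewrite -def_v -def_w vP wP.
    + by rewrite def_v def_w eqxx in neq_vw.
  - by rewrite vertex_of_tau1.
  - by rewrite vertex_of_tau2.
pose cls b := [set vertex_of x | x : flag H & chi x == b].
exists (cls true), (cls false); split.
- apply/setP=> v; rewrite inE; apply/orP/imsetP => [|[x _ ->]].
    by case=> /imsetP[x _ ->]; exists x.
  by case chix: (chi x); [left | right]; apply: imset_f; rewrite inE chix.
- apply/pred0P=> v; apply/andP=> -[] /= /imsetP[x]; rewrite inE => /eqP chix ->.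
  case/imsetP=> y; rewrite inE => /eqP chiy eq_xy.
  have: x \in vertex_of y by rewrite -eq_xy; apply: orbit_refl.
  by move/(vertex_of_invariant chi1 chi2); rewrite chix chiy.
move=> a /imsetP[x _ ->]; rewrite /ends imsetU1 imset_set1.
case chix: (chi x).
  exists (vertex_of x), (vertex_of (tau0 H x)).
  by split=> //; apply: imset_f; rewrite inE ?chi0 chix.
exists (vertex_of (tau0 H x)), (vertex_of x).
by split; [| |rewrite setUC]; rewrite ?imset_f // inE ?chi0 chix.
Qed.

(** * Existence of local orientation systems *)

(** A power of the rotation [s \o t] that agrees with [t] at [x] would close an
    odd alternating cycle.  Moving to [s (t x)] lowers the exponent by two, and
    exponents 0 and 1 give a fixed point of [t] and of [s]. *)
Lemma reflection_neq_rotation (T : finType) (s t : {perm T}) k x :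
  fpf_involution s -> fpf_involution t -> iter k (s \o t) x != t x.
Proof.
case=> sK sN [tK tN]; have [m] := ubnP k.
elim: m => // m IHm in k x *; rewrite ltnS; case: k => [|[|k]] lekm.
- by rewrite eq_sym.
- exact: sN.
have /(IHm k (s (t x))) : k < m by apply: ltn_trans lekm.
apply: contraNneq => eq_t; apply/eqP; move: eq_t.
by rewrite iterS -[s (t x)]/((s \o t) x) -iterSr /= => <-; rewrite sK tK.
Qed.

(** The cycles of the rotation [tau0 \o tau2] come in pairs exchanged by both
    [tau0] and [tau2]; comparing representatives selects one cycle of each
    pair. *)
Lemma exists_local_orientation (H : hypermap) :
  exists omega : flag H -> bool, local_orientation omega.
Proof.
pose r := tau0 H \o tau2 H.
have injr : injective r by apply: inj_comp; apply: perm_inj.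
have root_r x : froot r (r x) = froot r x.
  by apply/esym/rootP; [exact: fconnect_sym | exact: fconnect1].
have root_tau0 x : froot r (tau0 H x) = froot r (tau2 H x).
  by rewrite -[in LHS](tau2K x) root_r.
pose rk x := enum_rank (froot r x).
have rk_neq x : rk (tau2 H x) != rk x.
  apply/eqP=> /enum_rank_inj/esym/(rootP (fconnect_sym injr))/iter_findex.
  apply/eqP; exact: reflection_neq_rotation (tau0_fpf H) (tau2_fpf H).
exists (fun x => rk x < rk (tau2 H x)).
have flip x : (rk (tau2 H x) < rk x) = ~~ (rk x < rk (tau2 H x)).
  by rewrite -leqNgt ltn_neqAle rk_neq.
split=> x; rewrite -flip; last by rewrite tau2K.
by rewrite /rk -(root_tau0 (tau0 H x)) tau0K root_tau0.
Qed.

(** * Orientations of the modified medial map *)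

Section ModifiedMedial.
Variables (H : hypermap) (omega : flag H -> bool).
Implicit Types (x : flag H) (Phi : flag (modified_medial omega) -> bool).

Lemma bar_constant Phi : bars_source_or_sink Phi ->
  forall z : {y | y \in twisted omega},
  forall f, f \in @vertex_of (modified_medial omega) (inr z) ->
  Phi f = Phi (inr z).
Proof.
move=> bars z f fz.
have zz : inr z \in @vertex_of (modified_medial omega) (inr z).
  exact: orbit_refl.
case: (bars z) => hz; first by rewrite (hz _ fz) (hz _ zz).
by rewrite (negPf (hz _ fz)) (negPf (hz _ zz)).
Qed.

(** Along an untwisted edge the direction seen from the medial vertex changes
    once; along a twisted one it changes at each segment and is kept across the
    bar, hence is the same at both ends. *)
Lemma delta_tau1 Phi : orientation Phi -> bars_source_or_sink Phi ->
  forall x, delta Phi (tau1 H x) = ~~ delta Phi x (+) twist omega x.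
Proof.
move=> [_ flip0] bars x; rewrite /delta.
have := flip0 (inl (x, true)); rewrite permE /= /bar_tau0.
case: insubP => [z|]; rewrite inE /= => twx.
  move=> def_z flip; rewrite twx addbT negbK.
  have := flip0 (tau1 (modified_medial omega) (inr z)).
  rewrite [in RHS](bar_constant bars (z := z)); last first.
    by rewrite -vertex_of_tau1; apply: orbit_refl.
  rewrite flip negbK !permE; case: z def_z {flip} => y yT /= -> <-.
  by rewrite permE.
by move=> flip; rewrite (negPf twx) addbF -flip permE.
Qed.

Lemma orientation_of_delta (d : flag H -> bool) :
  (forall x, d (tau1 H x) = ~~ d x (+) twist omega x) ->
  exists Phi, [/\ orientation Phi, bars_source_or_sink Phi &
                  delta Phi =1 d].
Proof.
move=> d1.
pose Phi (f : flag (modified_medial omega)) :=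
  match f with inl y => d y.1 | inr z => ~~ d (val z).1 end.
have bar1 z : Phi (tau1 (modified_medial omega) (inr z)) = Phi (inr z).
  case: z => y yT; rewrite permE /= permE /= d1.
  by move: (yT); rewrite inE => ->; rewrite addbT negbK.
have all2 f : Phi (tau2 (modified_medial omega) f) = Phi f.
  by rewrite permE; case: f => [y|[y yT]] /=; rewrite permE.
exists Phi; split=> //.
  split=> // f; rewrite permE; case: f => [y|z] /=; last by rewrite negbK.
  case: insubP => [z _ <- //|]; rewrite inE /= permE /= d1 => /negPf->.
  by rewrite addbF.
move=> z bar.
have Phi_bar f : f \in bar -> Phi f = Phi (inr z).
  (* tau1 preserves Phi only at flags of bars, so the invariant set has to record
     that the orbit never leaves them. *)
  suff /subsetP sub : bar \subset
      [set g : flag (modified_medial omega) |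
         (if g is inr _ then true else false) && (Phi g == Phi (inr z))].
    by move/sub; rewrite inE => /andP[_ /eqP].
  apply: orbit_gen_sub => [s g|]; last by rewrite inE eqxx.
  rewrite !inE => sE; case: g => // w /=.
  case/orP: sE => /eqP->; rewrite ?bar1 ?all2 ?andbT => ->; rewrite andbT permE.
    by case: w.
  by case: w.
case Phiz: (Phi (inr z)); [left | right] => f /Phi_bar->; by rewrite Phiz.
Qed.

End ModifiedMedial.

(** * The change of variable *)

Section Twisting.
Variables (H : hypermap) (A : {set {set flag H}}) (hA : A \subset hyperedges H).
Variables (omega : flag H -> bool) (omegaP : local_orientation omega).
Implicit Types Phi : flag (modified_medial omega) -> bool.

Lemma coloring_of_all_crossing Phi :
  orientation Phi -> bars_source_or_sink Phi -> all_crossing Phi ->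
  A = c_hyperedges Phi ->
  @flag_coloring (partial_dual hA) (fun x => delta Phi x (+) omega x).
Proof.
move=> orP barP acP defA; have [w0 w2] := omegaP.
have crossing (x : flag H) : if x \in cover A
    then delta Phi (tau2 H x) = delta Phi x /\
         delta Phi (tau0 H x) = ~~ delta Phi x
    else delta Phi (tau0 H x) = delta Phi x /\
         delta Phi (tau2 H x) = ~~ delta Phi x.
  rewrite (mem_cover_hyperedges _ hA) [in _ \in A]defA inE hyperedge_of_in /=.
  have := acP _ (hyperedge_of_in x); case: ifP => [cx _ | _ /= dx].
    by have /forall_inP/(_ x (mem_hyperedge_of x))/andP[/eqP ? /eqP ?] := cx.
  by have /forall_inP/(_ x (mem_hyperedge_of x))/andP[/eqP ? /eqP ?] := dx.
split=> x.
- rewrite permE /dual_tau0; have := crossing x.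
  by case: ifP => _ [-> e]; rewrite ?w0 ?w2 addbN.
- by rewrite -[tau1 _ x]/(tau1 H x) delta_tau1 // twistE; case: (delta _ _); case: (twist _ _); case: (omega _).
- rewrite permE /dual_tau2; have := crossing x.
  by case: ifP => _ [_ ->]; rewrite ?w0 ?w2 addbN addNb negbK.
Qed.

Lemma all_crossing_of_coloring (chi : flag H -> bool) :
  @flag_coloring (partial_dual hA) chi ->
  exists Phi, [/\ orientation Phi, bars_source_or_sink Phi, all_crossing Phi &
                  A = c_hyperedges Phi].
Proof.
case=> chi0 chi1 chi2; have [w0 w2] := omegaP.
pose d x := chi x (+) omega x.
have d1 x : d (tau1 H x) = ~~ d x (+) twist omega x.
  by rewrite /d chi1 twistE addNb addbN addNb addbA.
have [Phi [orP barP defd]] := orientation_of_delta d1.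
have crossing (x : flag H) :
  [/\ d (tau2 H x) = ~~ d x (+) (x \in cover A) &
      d (tau0 H x) = d x (+) (x \in cover A)].
  have := chi0 x; have := chi2 x; rewrite !permE /dual_tau0 /dual_tau2 /d w0 w2.
  by case: ifP => _ -> ->; case: (chi x); case: (omega x).
have type_of (e : {set flag H}) : e \in hyperedges H ->
    c_type Phi e = (e \in A) /\ d_type Phi e = (e \notin A).
  case/imsetP=> x0 _ ->.
  have in_e x : x \in hyperedge_of x0 -> (x \in cover A) = (hyperedge_of x0 \in A).
    by move/hyperedge_of_invariant=> <-; apply: mem_cover_hyperedges.
  have x0e := mem_hyperedge_of x0.
  split.
    apply/forall_inP/idP => [/(_ x0 x0e)|eA x xe].
      rewrite !defd; have [-> _] := crossing x0; rewrite (in_e _ x0e).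
      by case: (_ \in A); case: (d x0).
    rewrite !defd; have [-> ->] := crossing x; rewrite (in_e _ xe) eA.
    by case: (d x).
  apply/forall_inP/idP => [/(_ x0 x0e)|eA x xe].
    rewrite !defd; have [-> ->] := crossing x0; rewrite (in_e _ x0e).
    by case: (_ \in A); case: (d x0).
  rewrite !defd; have [-> ->] := crossing x; rewrite (in_e _ xe) (negPf eA).
  by case: (d x).
exists Phi; split=> //.
  by move=> e /type_of[-> ->]; case: (e \in A).
apply/setP=> e; rewrite inE; apply/idP/andP => [eA | [eH]].
  by have eH := subsetP hA _ eA; have [-> _] := type_of _ eH.
by have [-> _] := type_of _ eH.
Qed.

End Twisting.

Theorem theorem6p1 (H : hypermap) (A : {set {set flag H}})
    (hA : A \subset hyperedges H) :
  bipartite (partial_dual hA) <->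
  (forall omega : flag H -> bool, local_orientation omega ->
     exists Phi : flag (modified_medial omega) -> bool,
       [/\ orientation Phi, bars_source_or_sink Phi, all_crossing Phi &
           A = c_hyperedges Phi]).
Proof.
split=> [/bipartite_flag_coloring[chi chiP] omega omegaP | hPhi].
  exact: all_crossing_of_coloring chiP.
have [omega omegaP] := exists_local_orientation H.
have [Phi [orP barP acP defA]] := hPhi _ omegaP.
by apply/bipartite_flag_coloring; eexists; apply: coloring_of_all_crossing acP defA.
Qed.
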